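(* Assume that (1) the chain with kernel $p$ has a unique stationary distribution $\mu$ and $\mu(U)>0$ for every non-empty (relatively) open $U\subseteq\mathcal S$; (2) $\sup_{s\in\mathcal S}\|x(s)\|<\infty$ and $\sup_{s\in\mathcal S}|r(s)|<\infty$; (3) for every measurable $f:\mathcal S\to\mathbb R^n$ with $f=0$ $\mu$-a.e., also $P_\pi f=0$ $\mu$-a.e. Let $w(t)$ be a bounded solution on $(-\infty,+\infty)$ of the ODE $\frac{dw(t)}{dt}=Aw(t)+b$, i.e. $\sup_{t\in(-\infty,+\infty)}\|w(t)\|<\infty$. Then $w(t)$ is constant and lies in $\mathcal W_*$: there exists $w_*\in\mathcal W_*$ such that $w(t)=w_*$ for all $t\in(-\infty,+\infty)$.
   Context: Setting: $K,d\in\mathbb N$; $\mathcal S\subseteq\mathbb R^K$ with its Borel $\sigma$-algebra; $p(\cdot\mid s)$ is a Markov transition kernel on $\mathcal S$; $r:\mathcal S\to\mathbb R$ is measurable; $\gamma\in[0,1)$; $x:\mathcal S\to\mathbb R^d$ is a measurable feature map (no linear independence is assumed). $(P_\pi f)(s)=\int_{\mathcal S}f(s')\,p(ds'\mid s)$. A stationary distribution is a probability measure $\mu$ with $\mu(Z)=\int_{\mathcal S}p(Z\mid s)\mu(ds)$ for all Borel $Z\subseteq\mathcal S$. $A=\int_{\mathcal S}x(s)\left(\gamma(P_\pi x)(s)^\top-x(s)^\top\right)\mu(ds)\in\mathbb R^{d\times d}$, $b=\int_{\mathcal S}x(s)r(s)\mu(ds)\in\mathbb R^d$, $\mathcal W_*=\{w\in\mathbb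 R^d: Aw+b=0\}$. *)

(* Defs.v *)
From HB Require Import structures.
From mathcomp Require Import all_boot all_order all_algebra.
From mathcomp Require Import all_classical all_reals all_analysis.

Set Implicit Arguments.
Unset Strict Implicit.
Unset Printing Implicit Defensive.
Import Order.TTheory GRing.Theory Num.Theory.
Import numFieldNormedType.Exports.

Local Open Scope classical_set_scope.
Local Open Scope ring_scope.

(** [borel T] is [T] with the sigma-algebra generated by its open sets. *)
Notation borel T := (g_sigma_algebraType (@open T)).

(** The subset [S] of [R^K] as a type, with the relative topology.  Measurable
    types of the library are pointed, hence the proof of non-emptiness; it is no
    restriction when [S] carries a probability measure. *)
Definition state_space (R : realType) (K : nat) (S : set 'rV[R]_K)
  (S0 : S !=set0) : Type := set_type S.

Section state_space_instances.
Variables (R : realType) (K : nat) (S : set 'rV[R]_K) (S0 : S !=set0).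

HB.instance Definition _ := Topological.copy (state_space S0) (set_type S).
HB.instance Definition _ := isPointed.Build (state_space S0)
  (exist _ (sval (cid S0)) (mem_set (svalP (cid S0)))).

End state_space_instances.

Definition enorm (R : realType) (n : nat) (v : 'cV[R]_n) : R :=
  Num.sqrt (\sum_(i < n) v i ord0 ^+ 2).

(** Entrywise integral of a matrix-valued function. *)
Definition mxintegral (d : measure_display) (T : measurableType d)
  (R : realType) (mu : {measure set T -> \bar R}) (m n : nat)
  (F : T -> 'M[R]_(m, n)) : 'M[R]_(m, n) :=
  \matrix_(i < m, j < n) (\int[mu]_s F s i j).

Section markov_chain.
Variables (dT : measure_display) (T : measurableType dT) (R : realType).
Variable p : R.-pker T ~> T.

Definition stationary (mu : probability T R) : Prop :=
  forall Z : set T, measurable Z -> mu Z = (\int[mu]_s p s Z)%E.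

(** Uniqueness is agreement on measurable sets: the values of a library measure
    outside the sigma-algebra carry no meaning. *)
Definition unique_stationary (mu : probability T R) : Prop :=
  stationary mu /\
  forall nu : probability T R, stationary nu ->
    forall Z : set T, measurable Z -> nu Z = mu Z.

Definition transition (n : nat) (f : T -> 'cV[R]_n) (s : T) : 'cV[R]_n :=
  mxintegral (p s) f.

Definition td_matrix (mu : probability T R) (gamma : R) (d : nat)
  (x : T -> 'cV[R]_d) : 'M[R]_d :=
  mxintegral mu (fun s => x s *m (gamma *: (transition x s)^T - (x s)^T)).

Definition td_vector (mu : probability T R) (r : T -> R) (d : nat)
  (x : T -> 'cV[R]_d) : 'cV[R]_d :=
  mxintegral mu (fun s => r s *: x s).

Definition td_fixed_points (mu : probability T R) (gamma : R) (r : T -> R)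
  (d : nat) (x : T -> 'cV[R]_d) : set 'cV[R]_d :=
  [set w | td_matrix mu gamma x *m w + td_vector mu r x = 0].

End markov_chain.

(* Main.v *)
Require Import Defs.
From HB Require Import structures.
From mathcomp Require Import all_boot all_order all_algebra.
From mathcomp Require Import all_classical all_reals all_analysis.
From mathcomp Require Import measurable_realfun ring lra.
Set Implicit Arguments.
Unset Strict Implicit.
Unset Printing Implicit Defensive.
Import Order.TTheory GRing.Theory Num.Theory.
Import numFieldNormedType.Exports.
Local Open Scope classical_set_scope.
Local Open Scope ring_scope.

(** Put [G = \int x x^T dmu].  By stationarity of [mu] and Jensen's inequality,
    [P] contracts [L^2(mu)], so [v^T A v <= - (1 - gamma) v^T G v].  If [G v = 0] then
    [v^T x = 0] almost everywhere, hence [v^T A = 0] and [v^T b = 0]: the velocity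
    [u = A w + b] is orthogonal to the kernel of the symmetric matrix [G], and there
    [G] is coercive.  So [|u|^2] decays at an exponential rate; being bounded on the
    whole line, it vanishes. *)

(** * A scalar decay estimate on the whole line *)

(** Only the mean value theorem is used. As [f] is nonincreasing, a positive [f t] forces slopes at
    most [- k * f t] at all earlier times, and far enough back [f] would exceed [M]. *)
Lemma bounded_decay_eq0 (R : realType) (f df : R -> R) (k M : R) :
  0 < k -> (forall t : R, is_derive t (1 : R) f (df t)) ->
  (forall t, 0 <= f t <= M) -> (forall t, df t <= - k * f t) ->
  forall t, f t = 0.
Proof.
move=> k0 fE fM dfle t.
have mvt a : a < t -> exists2 c, c < t & f t - f a = df c * (t - a).
  move=> at_.
  have dfa c : c \in `]a, t[ -> is_derive c (1 : R) f (df c) by move=> _; exact: fE.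
  have cf : {within `[a, t], continuous f}.
    apply: derivable_within_continuous => c _.
    exact: (@ex_derive _ _ _ _ _ _ _ (fE c)).
  have [c] := MVT at_ dfa cf.
  by rewrite in_itv => /andP[_ ct] fta; exists c.
have f_decr a : a < t -> f t <= f a.
  move=> at_; have [c _ fta] := mvt _ at_.
  have /andP[fc0 _] := fM c.
  rewrite -subr_le0 fta pmulr_lle0 ?subr_gt0//.
  by rewrite (le_trans (dfle c))// mulNr oppr_le0 mulr_ge0// ltW.
apply/eqP; rewrite eq_le; have /andP[-> _] := fM t; rewrite andbT.
rewrite leNgt; apply/negP => ft0.
(* In time [h] a slope of size [k * f t] moves [f] by [M + 1], more than its range allows. *)
pose h := (M + 1) / (k * f t).
have M0 : 0 <= M by have /andP[/le_trans] := fM t; apply.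
have h0 : 0 < h by rewrite divr_gt0 ?mulr_gt0// ltr_wpDl.
have hE : h * (k * f t) = M + 1 by rewrite divfK// gt_eqF// mulr_gt0.
have [|c ct] := mvt (t - h); first by rewrite ltrBlDr ltrDl.
have -> : t - (t - h) = h by ring.
have /andP[fh0 fhM] := fM (t - h).
move=> fth.
have : df c * h <= - (M + 1).
  rewrite -hE mulrC -mulrN ler_pM2l// (le_trans (dfle c))// mulNr lerN2.
  by rewrite ler_pM2l// f_decr.
by rewrite -fth; lra.
Qed.

Lemma is_derive_coord {R : realType} {m n : nat} {w : R -> 'M[R]_(m, n)}
    {t : R} {dw : 'M[R]_(m, n)} i j :
  is_derive t 1 w dw -> is_derive t (1 : R) (fun s => w s i j) (dw i j).
Proof.
move=> [dwt <-]; split; first by move/derivable_mxP : dwt; exact.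
by rewrite derive_mx// mxE.
Qed.

(** * Quadratic forms and dissipative linear flows *)

Section quadratic_form.
Context {R : realType} {d : nat}.
Implicit Types (A G : 'M[R]_d) (u v b : 'cV[R]_d).

(** At [1%:M] this is the squared Euclidean norm, the Lyapunov function of the flow below. *)
Definition qform A v : R := (v^T *m A *m v) ord0 ord0.

Lemma qform1E v : qform 1%:M v = \sum_i v i ord0 ^+ 2.
Proof. by rewrite /qform mulmx1 mxE; apply: eq_bigr => i _; rewrite mxE expr2. Qed.

Lemma qform1_ge0 v : 0 <= qform 1%:M v.
Proof. by rewrite qform1E sumr_ge0// => i _; exact: sqr_ge0. Qed.

Lemma qform1_eq0 v : qform 1%:M v = 0 -> v = 0.
Proof.
rewrite qform1E => /eqP; rewrite psumr_eq0; last by move=> i _; exact: sqr_ge0.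
move=> /allP v0; apply/colP => i; rewrite mxE.
by have := v0 i (mem_index_enum _); rewrite sqrf_eq0 => /eqP.
Qed.

Lemma qformE A v : qform A v = \sum_i \sum_j v i ord0 * A i j * v j ord0.
Proof.
rewrite /qform mxE exchange_big /=; apply: eq_bigr => j _.
by rewrite mxE big_distrl /=; apply: eq_bigr => i _; rewrite mxE.
Qed.

(** A product of two coordinates is at most [|v|^2] in absolute value, so the absolute entries of
    [A] sum to a bound. The extra 1 makes [C] invertible for the coercivity estimate. *)
Lemma qform_bounded A : exists2 C, 1 <= C & forall v, qform A v <= C * qform 1%:M v.
Proof.
exists (1 + \sum_i \sum_j `|A i j|).
  by rewrite lerDl sumr_ge0// => i _; rewrite sumr_ge0.
move=> v; rewrite mulrDl mul1r; apply: ler_wpDl; first exact: qform1_ge0.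
have vle i : v i ord0 ^+ 2 <= qform 1%:M v.
  by rewrite qform1E (bigD1 i)//= lerDl sumr_ge0// => j _; exact: sqr_ge0.
rewrite qformE mulr_suml; apply: ler_sum => i _.
rewrite mulr_suml; apply: ler_sum => j _.
apply: le_trans (ler_norm _) _.
rewrite mulrAC normrM mulrC ler_wpM2l//.
have := vle i; have := vle j.
by rewrite ler_norml; set q := qform _ _ => *; apply/andP; split; nra.
Qed.

(* With [u = G y], expand [0 <= (u - e y)^T G (u - e y)] and take [e = 1 / C]. *)
Lemma qform_coercive G :
  G^T = G -> (forall v, 0 <= qform G v) ->
  exists2 c, 0 < c &
    forall u, (u^T <= G)%MS -> c * qform 1%:M u <= qform G u.
Proof.
move=> GT G0; have [C C1 pinvC] := qform_bounded (pinvmx G).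
have C0 : 0 < C by exact: lt_le_trans C1.
exists C^-1; first by rewrite invr_gt0.
move=> u uG.
(* A preimage of [u] under [G]: [pinvmx] inverts [G] on its row space, and symmetry turns rows into
   columns. *)
pose y := (pinvmx G)^T *m u.
have yG : y^T *m G = u^T by rewrite trmx_mul trmxK mulmxKpV.
have Gy : G *m y = u by apply: trmx_inj; rewrite trmx_mul GT.
have yu : u^T *m y = u^T *m pinvmx G *m u.
  have tr1 (M : 'M[R]_1) : M^T = M by apply/matrixP => i j; rewrite mxE !ord1.
  by rewrite -[LHS]tr1 /y !trmx_mul !trmxK.
have expand e : qform G (u - e *: y) =
    qform G u - (2 * e) * qform 1%:M u + e ^+ 2 * qform (pinvmx G) u.
  suff E : (u - e *: y)^T *m G *m (u - e *: y) =
    u^T *m G *m u - (2 * e) *: (u^T *m u) + e ^+ 2 *: (u^T *m pinvmx G *m u).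
    by rewrite /qform E mulmx1 !mxE.
  have -> : (u - e *: y)^T = u^T - e *: y^T by apply/rowP => j; rewrite !mxE.
  rewrite mulmxBl -scalemxAl yG mulmxBr !mulmxBl -!scalemxAr.
  rewrite -!scalemxAl -(mulmxA u^T G y) Gy yu scalerA -expr2.
  rewrite opprB addrA [2 * e]mulrDl mul1r scalerDl opprD !addrA.
  by rewrite [RHS]addrAC.
have := G0 (u - C^-1 *: y); rewrite expand.
(* For [e = 1 / C] the quadratic term cancels at most half of the cross term [2 e |u|^2]; the other
   half is the coercivity bound. *)
have : C^-1 ^+ 2 * qform (pinvmx G) u <= C^-1 * qform 1%:M u.
  rewrite expr2 -mulrA ler_pM2l ?invr_gt0//.
  by rewrite mulrC ler_pdivrMr// mulrC.
by lra.
Qed.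

(* Decay of [|u|^2] for the velocity [u = A w + b], which stays in the row space of
   [G] because it is orthogonal to the kernel of [G]. *)
Lemma bounded_dissipative_flow_cst (A G : 'M[R]_d) (b : 'cV[R]_d) (k M : R)
    (w : R -> 'cV[R]_d) :
  0 < k -> G^T = G -> (forall v, 0 <= qform G v) ->
  (forall v, qform A v <= - k * qform G v) ->
  (forall v, G *m v = 0 -> v^T *m A = 0 /\ v^T *m b = 0) ->
  (forall t : R, is_derive t (1 : R) w (A *m w t + b)) ->
  (forall t i, `|w t i ord0| <= M) ->
  forall t, A *m w t + b = 0 /\ w t = w 0.
Proof.
move=> k0 GT G0 AG kerG w_ode wM.
pose u t := A *m w t + b.
have uG t : ((u t)^T <= G)%MS.
  (* Membership in the row space is tested against the columns of [cokermx G], which lie in the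
     kernel of [G]. *)
  rewrite submxE; apply/eqP/row_matrixP => i; rewrite row0.
  apply/rowP => j; rewrite mxE mxE.
  have [|kA kb] := kerG (col j (cokermx G)).
    by rewrite colE mulmxA mulmx_coker mul0mx.
  have : (col j (cokermx G))^T *m u t = 0.
    by rewrite mulmxDr mulmxA kA kb mul0mx addr0.
  move: (u t) => v /(congr1 (fun N : 'M[R]_1 => N ord0 ord0)); rewrite !mxE => vj.
  by rewrite -[RHS]vj; apply: eq_bigr => l _; rewrite !mxE ord1 mulrC.
(* As [b] is constant, the velocity solves the homogeneous equation [u' = A u]. *)
have uE (t : R) i : is_derive t (1 : R) (fun s => u s i ord0) ((A *m u t) i ord0).
  have -> : (fun s => u s i ord0) =
      \sum_j (fun s => A i j *: w s j ord0 : R) + cst (b i ord0).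
    by apply/funext => s; rewrite !mxE fctE fct_sumE.
  have wE j := is_derive_coord j ord0 (w_ode t).
  apply: is_derive_eq; rewrite addr0 mxE; apply: eq_bigr => j _; exact: erefl.
pose phi t := qform 1%:M (u t).
have phiE (t : R) : is_derive t (1 : R) phi (2 * qform A (u t)).
  have -> : phi = \sum_i (fun s => u s i ord0) ^+ 2.
    by apply/funext => s; rewrite /phi qform1E fct_sumE; apply: eq_bigr.
  apply: is_derive_eq.
  rewrite /qform -mulmxA mxE mulr_sumr; apply: eq_bigr => i _.
  by rewrite [(u t)^T _ _]mxE expr1 mulrA.
have uM t i : `|u t i ord0| <= \sum_j `|A i j| * M + `|b i ord0|.
  rewrite !mxE (le_trans (ler_normD _ _))// lerD2r.
  rewrite (le_trans (ler_norm_sum _ _ _))//; apply: ler_sum => j _.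
  by rewrite normrM ler_wpM2l.
have phiM t : 0 <= phi t <= \sum_i (\sum_j `|A i j| * M + `|b i ord0|) ^+ 2.
  rewrite qform1_ge0/= /phi qform1E; apply: ler_sum => i _.
  by rewrite -real_normK ?num_real// lerXn2r ?nnegrE// (le_trans _ (uM t i)).
have [c c0 coercive] := qform_coercive GT G0.
have u0 t : u t = 0.
  (* The rate comes from [phi' = 2 u^T A u <= - 2 k u^T G u <= - 2 k c |u|^2]. *)
  apply: qform1_eq0; apply: (bounded_decay_eq0 (k := 2 * (k * c)) _ phiE phiM).
    by rewrite !mulr_gt0.
  move=> s; rewrite mulNr -mulrA -mulrN ler_pM2l//.
  rewrite (le_trans (AG _))// mulNr lerN2 -mulrA ler_pM2l//.
  exact: coercive.
move=> t; split; first exact: u0.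
apply/colP => i.
apply: (is_derive_0_is_cst (f := fun s => w s i ord0)) => s.
by have := is_derive_coord i ord0 (w_ode s); rewrite -/(u s) u0 mxE.
Qed.
End quadratic_form.

(** * Integrals of bounded measurable functions against a probability *)

Section bounded_integrals.
Context {dT : measure_display} {T : measurableType dT} {R : realType}.
Implicit Types (f g : T -> R) (mu : probability T R).

(** A class closed under sums, products and the transition kernel, and integrable for every
    probability, so that integrability reduces to closure properties. *)
Definition bounded_measurable f : Prop :=
  measurable_fun [set: T] f /\ exists M, forall s, `|f s| <= M.

Lemma bounded_measurable_cst (c : R) : bounded_measurable (cst c).
Proof. by split; [exact: measurable_cst | exists `|c|]. Qed.

Lemma bounded_measurableD f g : bounded_measurable f -> bounded_measurable g ->
  bounded_measurable (fun s => f s + g s).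
Proof.
move=> [mf [M fM]] [mg [N gN]]; split; first exact: measurable_funD.
by exists (M + N) => s; rewrite (le_trans (ler_normD _ _))// lerD.
Qed.

Lemma bounded_measurableM f g : bounded_measurable f -> bounded_measurable g ->
  bounded_measurable (fun s => f s * g s).
Proof.
move=> [mf [M fM]] [mg [N gN]]; split; first exact: measurable_funM.
by exists (M * N) => s; rewrite normrM ler_pM.
Qed.

Lemma bounded_measurableZ (c : R) f : bounded_measurable f ->
  bounded_measurable (fun s => c * f s).
Proof. exact: bounded_measurableM (bounded_measurable_cst c). Qed.

Lemma bounded_measurableB f g : bounded_measurable f -> bounded_measurable g ->
  bounded_measurable (fun s => f s - g s).
Proof.
move=> [mf [M fM]] [mg [N gN]]; split; first exact: measurable_funB.
by exists (M + N) => s; rewrite (le_trans (ler_normB _ _))// lerD.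
Qed.

Lemma bounded_measurable_sum (I : Type) (l : seq I) (F : I -> T -> R) :
  (forall i, bounded_measurable (F i)) ->
  bounded_measurable (fun s => \sum_(i <- l) F i s).
Proof.
move=> bF; elim: l => [|i l IH].
  under eq_fun do rewrite big_nil; exact: bounded_measurable_cst.
under eq_fun do rewrite big_cons; exact: bounded_measurableD.
Qed.

Lemma bounded_measurable_integrable mu f :
  bounded_measurable f -> mu.-integrable [set: T] (EFin \o f).
Proof.
move=> [mf [M fM]]; apply: measurable_bounded_integrable => //.
  by rewrite (le_lt_trans (probability_le1 _ _)) ?ltry.
exists M; split; first exact: num_real.
by move=> x Mx s _ /=; rewrite (le_trans (fM s))// ltW.
Qed.

Lemma Rintegral_prob_cst mu (c : R) : \int[mu]_s c = c.
Proof.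
have mu1 : mu [set: T] = 1%E by exact: probability_setT.
rewrite Rintegral_cst// (_ : fine _ = 1) ?mulr1//; exact: (congr1 fine mu1).
Qed.

Lemma Rintegral_bddD mu f g : bounded_measurable f -> bounded_measurable g ->
  \int[mu]_s (f s + g s) = \int[mu]_s f s + \int[mu]_s g s.
Proof. by move=> bf bg; rewrite RintegralD//; exact: bounded_measurable_integrable. Qed.

Lemma Rintegral_bddZ mu (c : R) f : bounded_measurable f ->
  \int[mu]_s (c * f s) = c * \int[mu]_s f s.
Proof. by move=> bf; rewrite RintegralZl//; exact: bounded_measurable_integrable. Qed.

Lemma le_Rintegral_bdd mu f g : bounded_measurable f -> bounded_measurable g ->
  (forall s, f s <= g s) -> \int[mu]_s f s <= \int[mu]_s g s.
Proof.
by move=> bf bg fg; apply: le_Rintegral => //; exact: bounded_measurable_integrable.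
Qed.

Lemma Rintegral_bdd_sum mu (I : Type) (l : seq I) (F : I -> T -> R) :
  (forall i, bounded_measurable (F i)) ->
  \int[mu]_s (\sum_(i <- l) F i s) = \sum_(i <- l) \int[mu]_s F i s.
Proof.
move=> bF; elim: l => [|i l IH].
  by under eq_Rintegral do rewrite big_nil; rewrite Rintegral_prob_cst big_nil.
under eq_Rintegral do rewrite big_cons.
by rewrite Rintegral_bddD ?big_cons ?IH//; exact: bounded_measurable_sum.
Qed.

Lemma Rintegral_norm_le mu f (M : R) : measurable_fun [set: T] f ->
  (forall s, `|f s| <= M) -> `|\int[mu]_s f s| <= M.
Proof.
move=> mf fM; have bf : bounded_measurable f by split=> //; exists M.
rewrite -[leRHS](Rintegral_prob_cst mu).
apply: le_trans (le_normr_Rintegral _ _) _ => //.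
  exact: bounded_measurable_integrable.
apply: le_Rintegral_bdd => //; last exact: bounded_measurable_cst.
split; first exact: measurableT_comp.
by exists M => s; rewrite normr_id.
Qed.

(** Jensen's inequality for the square, by integrating [2 c f <= f^2 + c^2] at the mean [c]. *)
Lemma sqr_Rintegral_le mu f : bounded_measurable f ->
  (\int[mu]_s f s) ^+ 2 <= \int[mu]_s (f s ^+ 2).
Proof.
move=> bf; set c := \int[mu]_s f s.
have bff : bounded_measurable (fun s => f s ^+ 2) by exact: bounded_measurableM.
have : \int[mu]_s (2 * c * f s) <= \int[mu]_s (f s ^+ 2 + c ^+ 2).
  apply: le_Rintegral_bdd; first exact: bounded_measurableZ.
    by apply: bounded_measurableD => //; exact: bounded_measurable_cst.
  by move=> s; have := sqr_ge0 (f s - c); rewrite sqrrB; lra.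
rewrite Rintegral_bddZ// -/c Rintegral_bddD//; last exact: bounded_measurable_cst.
by rewrite Rintegral_prob_cst; lra.
Qed.

(* [0 <= \int (t f + g)^2 = 2 t \int f g + \int g^2] for every [t]. *)
Lemma Rintegral_mul_eq0 mu f g : bounded_measurable f -> bounded_measurable g ->
  \int[mu]_s (f s ^+ 2) = 0 -> \int[mu]_s (f s * g s) = 0.
Proof.
move=> bf bg f20.
have bff : bounded_measurable (fun s => f s ^+ 2) by exact: bounded_measurableM.
have bgg : bounded_measurable (fun s => g s ^+ 2) by exact: bounded_measurableM.
have bfg : bounded_measurable (fun s => f s * g s) by exact: bounded_measurableM.
set I := \int[mu]_s _; set J := \int[mu]_s (g s ^+ 2).
have IJ t : 0 <= 2 * t * I + J.
  have -> : 2 * t * I + J = t ^+ 2 * \int[mu]_s (f s ^+ 2) + (2 * t * I + J).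
    by rewrite f20 mulr0 add0r.
  rewrite -!Rintegral_bddZ// -!Rintegral_bddD//.
  - by apply: Rintegral_ge0 => s _; have := sqr_ge0 (t * f s + g s); lra.
  - exact: bounded_measurableZ.
  - by apply: bounded_measurableD => //; exact: bounded_measurableZ.
  - exact: bounded_measurableZ.
apply/eqP/negPn/negP => I0.
(* At this [t] the affine expression [2 t I + J] equals [-1]. *)
have := IJ (- (J + 1) / (2 * I)).
have -> : 2 * (- (J + 1) / (2 * I)) * I = - (J + 1) by field.
lra.
Qed.

End bounded_integrals.

(** * The transition kernel on functions and its stationary measure *)

Section stationary_kernel.
Context {dT : measure_display} {T : measurableType dT} {R : realType}.
Variable p : R.-pker T ~> T.
Implicit Types (f : T -> R) (mu : probability T R).

(** The kernel [p] with a dummy first argument, the shape in which it composes with [mu] seen as a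
    constant kernel. *)
Definition kernel_snd (z : T * T) : {measure set T -> \bar R} := p z.2.

Let measurable_kernel_snd (U : set T) : measurable U ->
  measurable_fun [set: T * T] (kernel_snd ^~ U).
Proof. by move=> mU; exact: measurableT_comp (measurable_kernel p _ mU) _. Qed.

HB.instance Definition _ :=
  isKernel.Build _ _ _ _ _ kernel_snd measurable_kernel_snd.

Let kernel_snd_prob z : kernel_snd z [set: T] = 1%E.
Proof. exact: prob_kernel. Qed.

HB.instance Definition _ := Kernel_isProbability.Build _ _ _ _ _
  kernel_snd kernel_snd_prob.

(** The iterated integral is the integral against the composition of [mu] with [p], and stationarity
    says that this measure agrees with [mu]. *)
Lemma stationary_ge0_integral mu (f : T -> \bar R) :
  stationary p mu -> (forall s, 0 <= f s)%E -> measurable_fun [set: T] f ->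
  (\int[mu]_s (\int[p s]_z f z) = \int[mu]_s f s)%E.
Proof.
move=> pmu f0 mf.
have mmu : measurable_fun [set: T] (cst mu : T -> pprobability T R) by [].
(* Any base point would do for [point], since the first kernel is constant. *)
rewrite -(integral_kcomp (kprobability mmu) kernel_snd point f0 mf).
by apply: eq_measure_integral => Z mZ _; exact/esym/pmu.
Qed.

(** A name for [p s] that carries the probability structure, so that the lemmas on bounded integrals
    apply at each state. *)
Definition kernel_probability (s : T) : set T -> \bar R := p s.

HB.instance Definition _ s := Measure.copy (kernel_probability s) (p s).
HB.instance Definition _ s :=
  Measure_isProbability.Build _ _ _ (kernel_probability s) (prob_kernel s).

(** Adding the bound [M] makes the integrand nonnegative, where measurability of kernel integrals
    applies; as [p s] has mass one, the integral shifts by exactly [M]. *)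
Lemma kernel_Rintegral_measurable f : bounded_measurable f ->
  measurable_fun [set: T] (fun s => \int[p s]_z f z).
Proof.
move=> bf; have [mf [M fM]] := bf.
have -> : (fun s => \int[p s]_z f z) = (fun s => \int[p s]_z (f z + M) - M).
  apply/funext => s; rewrite -[in LHS](addrK M (\int[p s]_z f z)).
  congr (_ - _).
  have /esym := Rintegral_bddD (kernel_probability s) bf (bounded_measurable_cst M).
  by rewrite (Rintegral_prob_cst (kernel_probability s)).
apply: measurable_funB => //.
apply: measurableT_comp; first exact: fine_measurable.
apply: measurable_fun_integral_kernel.
- by move=> U mU; exact: measurable_kernel.
- by move=> z; rewrite lee_fin; have := fM z; rewrite ler_norml; lra.
- by apply/measurable_EFinP; exact: measurable_funD.
Qed.

Lemma bounded_measurable_kernel f : bounded_measurable f ->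
  bounded_measurable (fun s => \int[p s]_z f z).
Proof.
move=> bf; split; first exact: kernel_Rintegral_measurable.
have [mf [M fM]] := bf; exists M => s.
exact: (Rintegral_norm_le (kernel_probability s)).
Qed.

Lemma stationary_Rintegral mu f :
  stationary p mu -> bounded_measurable f -> (forall s, 0 <= f s) ->
  \int[mu]_s (\int[p s]_z f z) = \int[mu]_s f s.
Proof.
move=> pmu bf f0; rewrite /Rintegral; congr fine.
rewrite -(stationary_ge0_integral (f := EFin \o f) pmu).
- apply: eq_integral => s _; rewrite fineK//.
  apply: (@integrable_fin_num _ _ _ (kernel_probability s)) => //.
  exact: bounded_measurable_integrable.
- by move=> s; rewrite lee_fin.
- by have [mf _] := bf; apply/measurable_EFinP.
Qed.

(* By Jensen the kernel contracts [L^2(mu)], so [\int f P f <= \int f^2]. *)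
Lemma stationary_dissipative mu f (gamma : R) :
  stationary p mu -> bounded_measurable f -> 0 <= gamma ->
  \int[mu]_s (f s * (gamma * \int[p s]_z f z - f s)) <=
    - (1 - gamma) * \int[mu]_s (f s * f s).
Proof.
move=> pmu bf gamma0; pose Pf s := \int[p s]_z f z.
have bff : bounded_measurable (fun s => f s * f s) by exact: bounded_measurableM.
have bPf : bounded_measurable Pf by exact: bounded_measurable_kernel.
have bPfPf : bounded_measurable (fun s => Pf s * Pf s) by exact: bounded_measurableM.
have PfPf : \int[mu]_s (Pf s * Pf s) <= \int[mu]_s (f s * f s).
  rewrite -(stationary_Rintegral pmu bff); last by move=> s; rewrite -expr2 sqr_ge0.
  apply: le_Rintegral_bdd => //; first exact: bounded_measurable_kernel.
  by move=> s; exact: (sqr_Rintegral_le (kernel_probability s)).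
(* Pointwise [f Pf <= (f^2 + Pf^2) / 2]. By [PfPf] each half then costs at most [gamma / 2] times
   the integral of [f^2]. *)
have : \int[mu]_s (f s * (gamma * Pf s - f s)) <=
    \int[mu]_s (gamma / 2 * (Pf s * Pf s) + (gamma / 2 - 1) * (f s * f s)).
  apply: le_Rintegral_bdd.
  - apply: bounded_measurableM => //; apply: bounded_measurableB => //.
    exact: bounded_measurableZ.
  - by apply: bounded_measurableD; exact: bounded_measurableZ.
  - by move=> s; have := sqr_ge0 (f s - Pf s); nra.
rewrite Rintegral_bddD; [|exact: bounded_measurableZ..].
rewrite !Rintegral_bddZ//; nra.
Qed.

End stationary_kernel.

(** * The TD matrix and vector compared with the Gram matrix *)

Section td_matrix.
Context {dT : measure_display} {T : measurableType dT} {R : realType}.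
Implicit Types (mu : probability T R).

Definition bounded_coord (n : nat) (x : T -> 'cV[R]_n) : Prop :=
  forall i, bounded_measurable (fun s => x s i ord0).

(** The scalar function [v^T x(s)]. *)
Definition lincomb (n : nat) (v : 'cV[R]_n) (x : T -> 'cV[R]_n) (s : T) : R :=
  \sum_i v i ord0 * x s i ord0.

Lemma bounded_measurable_lincomb (n : nat) (v : 'cV[R]_n) (x : T -> 'cV[R]_n) :
  bounded_coord x -> bounded_measurable (lincomb v x).
Proof.
by move=> bx; apply: bounded_measurable_sum => i; exact: bounded_measurableZ.
Qed.

(** The bridge from matrices to scalar integrals, used for the Gram matrix, [A] and [b] alike;
    finite sums commute with the integral. *)
Lemma mxintegral_bilinear mu (m n : nat) (x : T -> 'cV[R]_m) (y : T -> 'cV[R]_n)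
    (v : 'cV[R]_m) (c : 'cV[R]_n) :
  bounded_coord x -> bounded_coord y ->
  (v^T *m mxintegral mu (fun s => x s *m (y s)^T) *m c) ord0 ord0 =
  \int[mu]_s (lincomb v x s * lincomb c y s).
Proof.
move=> bx byy.
have bxy i j : bounded_measurable (fun s => x s i ord0 * y s j ord0).
  exact: bounded_measurableM.
have bvxy i j : bounded_measurable
    (fun s => v i ord0 * c j ord0 * (x s i ord0 * y s j ord0)).
  exact: bounded_measurableZ.
transitivity (\int[mu]_s (\sum_j \sum_i
    v i ord0 * c j ord0 * (x s i ord0 * y s j ord0))).
  rewrite Rintegral_bdd_sum; last first.
    by move=> j; exact: bounded_measurable_sum.
  rewrite mxE; apply: eq_bigr => j _.
  rewrite Rintegral_bdd_sum// mxE big_distrl/=; apply: eq_bigr => i _.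
  rewrite Rintegral_bddZ// !mxE mulrAC; congr (_ * _).
  by apply: eq_Rintegral => s _; rewrite !mxE big_ord1 mxE.
apply: eq_Rintegral => s _; rewrite /lincomb mulrC big_distrl/=.
apply: eq_bigr => j _; rewrite big_distrr/=; apply: eq_bigr => i _; ring.
Qed.

Section td.
Variables (p : R.-pker T ~> T) (mu : probability T R) (gamma : R) (r : T -> R).
Variables (d : nat) (x : T -> 'cV[R]_d).
Hypotheses (bx : bounded_coord x) (br : bounded_measurable r).

(** The expected temporal difference of the features; [A] is the integral of [x y^T]. *)
Let y s := gamma *: transition p x s - x s.
Let G := mxintegral mu (fun s => x s *m (x s)^T).

Let byy : bounded_coord y.
Proof.
move=> i; rewrite /y.
under eq_fun do rewrite !mxE.
apply: bounded_measurableB => //; apply: bounded_measurableZ.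
exact: bounded_measurable_kernel.
Qed.

Lemma td_matrixE : td_matrix p mu gamma x = mxintegral mu (fun s => x s *m (y s)^T).
Proof.
rewrite /td_matrix; congr mxintegral; apply/funext => s.
by congr (_ *m _); apply/rowP => j; rewrite !mxE.
Qed.

(** Reading the reward as a vector of dimension one gives [b] the same shape as [A], so that
    [gram_ker] treats both at once. *)
Lemma td_vectorE :
  td_vector mu r x = mxintegral mu (fun s => x s *m (const_mx (r s) : 'cV_1)^T).
Proof.
rewrite /td_vector; congr mxintegral; apply/funext => s.
by apply/colP => i; rewrite !mxE big_ord1 !mxE mulrC.
Qed.

(** Linearity moves [v] inside the transition operator, which reduces the estimates to the scalar
    function [v^T x]. *)
Lemma lincomb_td v s :
  lincomb v y s = gamma * \int[p s]_z lincomb v x z - lincomb v x s.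
Proof.
have -> : \int[p s]_z lincomb v x z = \sum_i v i ord0 * \int[p s]_z x z i ord0.
  rewrite [LHS](Rintegral_bdd_sum (kernel_probability p s)); last first.
    by move=> i; exact: bounded_measurableZ.
  by apply: eq_bigr => i _; exact: (Rintegral_bddZ (kernel_probability p s)).
rewrite mulr_sumr -sumrB; apply: eq_bigr => i _; rewrite /y !mxE; ring.
Qed.

Lemma gram_sym : G^T = G.
Proof.
apply/matrixP => i j; rewrite !mxE; apply: eq_Rintegral => s _.
by rewrite !mxE; apply: eq_bigr => k _; rewrite !mxE mulrC.
Qed.

Lemma qform_gram v : qform G v = \int[mu]_s (lincomb v x s * lincomb v x s).
Proof. exact: mxintegral_bilinear. Qed.

Lemma gram_ge0 v : 0 <= qform G v.
Proof.
by rewrite qform_gram; apply: Rintegral_ge0 => s _; rewrite -expr2 sqr_ge0.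
Qed.

Lemma qform_td_matrix_le v : stationary p mu -> 0 <= gamma ->
  qform (td_matrix p mu gamma x) v <= - (1 - gamma) * qform G v.
Proof.
move=> pmu gamma0; rewrite qform_gram td_matrixE /qform mxintegral_bilinear//.
under eq_Rintegral do rewrite lincomb_td.
by apply: stationary_dissipative => //; exact: bounded_measurable_lincomb.
Qed.

(** For [f = v^T x] the integral of [f^2] is [v^T G v = 0], so [f] is orthogonal to every bounded
    measurable function; the entries of [v^T A] and [v^T b] are such inner products. *)
Lemma gram_ker (v : 'cV[R]_d) : G *m v = 0 ->
  v^T *m td_matrix p mu gamma x = 0 /\ v^T *m td_vector mu r x = 0.
Proof.
move=> Gv0.
have xv0 : \int[mu]_s (lincomb v x s ^+ 2) = 0.
  by have := qform_gram v; rewrite /qform -mulmxA Gv0 mulmx0 mxE.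
have ker n (h : T -> 'cV[R]_n) : bounded_coord h ->
    v^T *m mxintegral mu (fun s => x s *m (h s)^T) = 0.
  move=> bh; apply/rowP => j; rewrite [RHS]mxE.
  (* The basis vector reads off the [j]-th entry. *)
  have := mxintegral_bilinear mu v (delta_mx j ord0) bx bh.
  rewrite Rintegral_mul_eq0//; [|exact: bounded_measurable_lincomb..].
  by rewrite -colE mxE.
rewrite td_matrixE td_vectorE; split; apply: ker => //.
by move=> i; under eq_fun do rewrite mxE.
Qed.

End td.
End td_matrix.

(** * From Borel measurability and finite suprema to bounded coordinates *)

(** Open rays generate the Borel sets of the line, and their preimages are open because coordinates
    are continuous. *)
Lemma measurable_coord (R : realType) (m n : nat) (i : 'I_m) (j : 'I_n) :
  measurable_fun [set: borel 'M[R]_(m, n)] (fun M : borel 'M[R]_(m, n) => M i j : R).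
Proof.
move=> mT; apply: (measurability _ (RGenOInfty.measurableE R)) => //.
move=> _ [_ [a ->] <-]; rewrite setTI; apply: sub_sigma_algebra.
have /continuousP : continuous (fun M : 'M[R]_(m, n) => M i j).
  exact: coord_continuous.
apply; exact: interval_open.
Qed.

Lemma ereal_sup_lty_bounded (R : realType) (I : Type) (f : I -> R) :
  (ereal_sup (range (fun i => (f i)%:E)) < +oo)%E -> exists M, forall i, f i <= M.
Proof.
move=> supf; exists (fine (ereal_sup (range (fun i => (f i)%:E)))) => i.
have : ((f i)%:E <= ereal_sup (range (fun i => (f i)%:E)))%E.
  by apply: ereal_sup_ubound; exists i.
(* The supremum is real: [supf] excludes [+oo], and the value at [i] excludes [-oo]. *)
by case: ereal_sup supf.
Qed.

Lemma le_enorm (R : realType) (n : nat) (v : 'cV[R]_n) i : `|v i ord0| <= enorm v.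
Proof.
rewrite -sqrtr_sqr ler_wsqrtr// (bigD1 i)//= lerDl sumr_ge0// => j _.
exact: sqr_ge0.
Qed.

Theorem theorem13 (R : realType) (K d : nat)
  (S : set 'rV[R]_K) (S0 : S !=set0)
  (p : R.-pker (borel (state_space S0)) ~> (borel (state_space S0)))
  (r : borel (state_space S0) -> R)
  (gamma : R)
  (x : borel (state_space S0) -> 'cV[R]_d)
  (mu : probability (borel (state_space S0)) R)
  (w : R -> 'cV[R]_d)
  (r_meas : measurable_fun [set: borel (state_space S0)] r)
  (gamma01 : 0 <= gamma < 1)
  (x_meas : measurable_fun [set: borel (state_space S0)]
              (x : borel (state_space S0) -> borel 'cV[R]_d))
  (mu_unique : unique_stationary p mu)
  (mu_open : forall U : set (state_space S0),
     open U -> U !=set0 -> (0 < mu U)%E)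
  (x_bounded : (ereal_sup (range (fun s => (enorm (x s))%:E)) < +oo)%E)
  (r_bounded : (ereal_sup (range (fun s => `|r s|%:E)) < +oo)%E)
  (transition_ae : forall (n : nat) (f : borel (state_space S0) -> 'cV[R]_n),
     measurable_fun [set: borel (state_space S0)]
       (f : borel (state_space S0) -> borel 'cV[R]_n) ->
     (\forall s \ae mu, f s = 0) ->
     (\forall s \ae mu, transition p f s = 0))
  (w_ode : forall t : R,
     is_derive t 1 w (td_matrix p mu gamma x *m w t + td_vector mu r x))
  (w_bounded : (ereal_sup (range (fun t => (enorm (w t))%:E)) < +oo)%E) :
  exists w_star : 'cV[R]_d,
    td_fixed_points p mu gamma r x w_star /\ forall t : R, w t = w_star.
Proof.
have [[mu_stat _] /andP[gamma0 gamma1]] := (mu_unique, gamma01).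
have [X xX] := ereal_sup_lty_bounded x_bounded.
have [Q rQ] := ereal_sup_lty_bounded r_bounded.
have [W wW] := ereal_sup_lty_bounded w_bounded.
have bx : bounded_coord x.
  move=> i; split; first exact: measurableT_comp (measurable_coord i ord0) x_meas.
  by exists X => s; rewrite (le_trans (le_enorm _ i)).
have br : bounded_measurable r by split=> //; exists Q.
pose G := mxintegral mu (fun s => x s *m (x s)^T).
have GT : G^T = G by exact: gram_sym.
have G0 v : 0 <= qform G v by exact: gram_ge0.
have AG v : qform (td_matrix p mu gamma x) v <= - (1 - gamma) * qform G v.
  exact: qform_td_matrix_le.
have kerG (v : 'cV[R]_d) : G *m v = 0 ->
    v^T *m td_matrix p mu gamma x = 0 /\ v^T *m td_vector mu r x = 0.
  exact: gram_ker.
have wb t i : `|w t i ord0| <= W by exact: le_trans (le_enorm _ i) (wW t).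
have k0 : 0 < 1 - gamma by rewrite subr_gt0.
have wE := bounded_dissipative_flow_cst k0 GT G0 AG kerG w_ode wb.
(* The velocity vanishes at time 0, which places [w 0] in the solution set. *)
by exists (w 0); split=> [|t]; apply wE.
Qed.
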